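(* Let $G$ be a super-$\lambda'$ graph. If $G$ is not $\lambda''$-connected, then $\rho'(G)=\delta(G)-1$, where $\delta(G)$ is the minimum vertex-degree of $G$.
   Context: All graphs are finite and simple. For a connected graph $G=(V,E)$ and an integer $h\geqslant 0$, a set $F\subseteq E(G)$ is an $h$-extra edge-cut if $G-F$ is disconnected and every component of $G-F$ has more than $h$ vertices. If such a set exists, $\lambda^{(h)}(G)$ is the minimum cardinality of an $h$-extra edge-cut, and $G$ is called $\lambda^{(h)}$-connected; otherwise $G$ is not $\lambda^{(h)}$-connected. A $\lambda^{(h)}$-cut is an $h$-extra edge-cut of cardinality $\lambda^{(h)}(G)$. Write $\lambda'=\lambda^{(1)}$ and $\lambda''=\lambda^{(2)}$. For an edge $xy$, its edge-degree is $d_G(x)+d_G(y)-2$, and $\xi(G)$ is the minimum edge-degree of $G$. A $\lambda'$-connected graph $G$ is super-$\lambda'$ if $\lambda'(G)=\xi(G)$ and, for every $\lambda'$-cut $F$ of $G$, some component of $G-F$ has exactly $2$ vertices. A disconnected graph is not super-$\lambda'$. For a super-$\lambda'$ graph $G$, the persistence $\rho'(G)$ is the maximum integer $m$ such that $G-F$ is still super-$\lambda'$ for every $F\subseteq E(G)$ with $|F|\leqslant m$. *)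

(* Defs.v *)
From mathcomp Require Import all_boot.

Set Implicit Arguments.
Unset Strict Implicit.
Unset Printing Implicit Defensive.

Record sgraph := SGraph {
  vertex :> finType;
  adj : rel vertex;
  adj_sym : symmetric adj;
  adj_irr : irreflexive adj
}.

Definition edges (G : sgraph) : {set {set G}} :=
  [set [set p.1; p.2] | p : G * G & adj p.1 p.2].

Definition del_adj (G : sgraph) (F : {set {set G}}) : rel G :=
  fun x y => adj x y && ([set x; y] \notin F).

Fact del_adj_sym (G : sgraph) (F : {set {set G}}) : symmetric (del_adj F).
Proof. by move=> x y; rewrite /del_adj adj_sym setUC. Qed.

Fact del_adj_irr (G : sgraph) (F : {set {set G}}) : irreflexive (del_adj F).
Proof. by move=> x; rewrite /del_adj adj_irr. Qed.

Definition del_edges (G : sgraph) (F : {set {set G}}) : sgraph :=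
  SGraph (del_adj_sym F) (del_adj_irr F).

Definition components (G : sgraph) : {set {set G}} :=
  equivalence_partition (connect (@adj G)) [set: G].

Definition connected (G : sgraph) : bool :=
  [forall x : G, forall y : G, connect (@adj G) x y].

Definition degree (G : sgraph) (x : G) : nat := #|[set y | adj x y]|.

(* The index of each iterated minn below is an upper bound of the values it
   ranges over, so it is the value only when there is nothing to minimise. *)

Definition min_degree (G : sgraph) : nat := \big[minn/#|G|]_(x : G) degree x.

(* The subtraction does not truncate when x and y are adjacent. *)
Definition edge_degree (G : sgraph) (x y : G) : nat := degree x + degree y - 2.

Definition min_edge_degree (G : sgraph) : nat :=
  \big[minn/#|G| + #|G|]_(p : G * G | adj p.1 p.2) edge_degree p.1 p.2.

Definition extra_edge_cut (h : nat) (G : sgraph) (F : {set {set G}}) : bool :=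
  [&& F \subset edges G, ~~ connected (del_edges F)
    & [forall C in components (del_edges F), h < #|C|]].

Definition lambda_connected (h : nat) (G : sgraph) : bool :=
  connected G && [exists F : {set {set G}}, extra_edge_cut h F].

Definition lambda (h : nat) (G : sgraph) : nat :=
  \big[minn/#|edges G|]_(F : {set {set G}} | extra_edge_cut h F) #|F|.

Definition lambda_cut (h : nat) (G : sgraph) (F : {set {set G}}) : bool :=
  extra_edge_cut h F && (#|F| == lambda h G).

Definition super_lambda' (G : sgraph) : bool :=
  [&& lambda_connected 1 G, lambda 1 G == min_edge_degree G
    & [forall F : {set {set G}}, lambda_cut 1 F ==>
        [exists C in components (del_edges F), #|C| == 2]]].

Definition persists (G : sgraph) (m : nat) : Prop :=
  forall F : {set {set G}},
    F \subset edges G -> #|F| <= m -> super_lambda' (del_edges F).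

(* [is_persistence G m] says that rho'(G) exists and equals m. *)
Definition is_persistence (G : sgraph) (m : nat) : Prop :=
  persists G m /\ forall m' : nat, persists G m' -> m' <= m.

(* Hence min_degree G - 1 does not truncate when G is super-lambda'. *)
Lemma super_lambda'_min_degree_gt0 (G : sgraph) :
  super_lambda' G -> 0 < min_degree G.
Proof.
case/and3P=> /andP[/forallP conG /existsP[F /and3P[_ ncF _]]] _ _.
have [x /existsP[y nxy]] : exists x : G, [exists y : G, x != y].
  case/forallPn: ncF => x /forallPn[y ncxy]; exists x; apply/existsP; exists y.
  by apply: contra ncxy => /eqP ->; apply: connect0.
rewrite /min_degree; apply: (big_ind (fun n => 0 < n)).
- by apply/card_gt0P; exists x.
- by move=> m n m0 n0; rewrite leq_min m0.
move=> z _; have [t nzt] : exists t : G, z != t.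
  by case: (eqVneq z x) => [->|zx]; [exists y | exists x].
case/connectP: (forallP (conG z) t) => [[|u p] /=].
  by move=> _ tz; rewrite tz eqxx in nzt.
by case/andP=> zu _ _; apply/card_gt0P; exists u; rewrite inE.
Qed.

(* Main.v *)
Require Import Defs.
From mathcomp Require Import all_boot all_order.

(** A 2-extra edge-cut of [G - F] yields one of [G], so when [G] is not
    [lambda'']-connected every 1-extra edge-cut [F'] of [G - F] isolates an
    edge, and [F'] has at least as many edges as the degree of that edge.
    Hence [G - F] is super-[lambda'] as soon as [lambda' (G - F) <= xi (G - F)],
    and by Esfahanian and Hakimi this holds for connected graphs of order at
    least 4 that are not stars.  Deleting fewer than [delta] edges keeps [G]
    connected, because [lambda' G = xi G >= 2 delta - 2], and never produces a
    star.  Deleting the [delta] edges at a vertex of minimum degree disconnects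
    [G]. *)

Set Implicit Arguments.
Unset Strict Implicit.
Unset Printing Implicit Defensive.

(** * Edges at a vertex, and minimum degrees *)

Definition neighbours (G : sgraph) (x : G) : {set G} := [set y | adj x y].

Definition edges_to (T : finType) (x : T) (A : {set T}) : {set {set T}} :=
  [set [set x; z] | z in A].

Definition del_class (G : sgraph) (F : {set {set G}}) (x : G) : {set G} :=
  [set y | connect (del_adj F) x y].

(** A connected graph in which every edge meets [c] is a star with centre [c]. *)
Definition not_star (G : sgraph) : Prop :=
  forall c : G, exists u v : G, [/\ adj u v, u != c & v != c].

Lemma eq_set2l (T : finType) (x : T) : injective (fun z : T => [set x; z]).
Proof.
move=> z w /= /setP eqzw; have := eqzw z; have := eqzw w.
rewrite !inE !eqxx !orbT /=; case: (eqVneq w x) => [->|_ /= /eqP //].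
by rewrite orbb => _ /esym/eqP.
Qed.

Lemma card_edges_to (T : finType) (x : T) (A : {set T}) :
  #|edges_to x A| = #|A|.
Proof. by rewrite card_imset //; apply: eq_set2l. Qed.

Lemma exists_neq (T : finType) (x : T) : 1 < #|T| -> exists y, y != x.
Proof.
rewrite -subn_gt0 subn1 -(cardC1 x) => /card_gt0P[y nyx].
by exists y.
Qed.

Lemma mem_edges_to (T : finType) (x u v : T) (A : {set T}) :
  ([set u; v] \in edges_to x A)
  = ((u == x) && (v \in A)) || ((v == x) && (u \in A)).
Proof.
apply/imsetP/orP => [[z zA eq_uv]|[/andP[/eqP-> vA]|/andP[/eqP-> uA]]].
- have := set21 x z; rewrite -eq_uv !inE => /orP[] /eqP eqx.
    by left; move: eq_uv; rewrite eqx eqxx => /eq_set2l ->.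
  by right; move: eq_uv; rewrite eqx eqxx setUC => /eq_set2l ->.
- by exists v.
- by exists u; rewrite // setUC.
Qed.

Lemma mem_edges (G : sgraph) (x y : G) : adj x y -> [set x; y] \in edges G.
Proof. by move=> xy; apply/imsetP; exists (x, y); rewrite ?inE. Qed.

Lemma edges_to_sub (G : sgraph) (x : G) (A : {set G}) :
  A \subset neighbours x -> edges_to x A \subset edges G.
Proof.
move=> sAN; apply/subsetP => _ /imsetP[z zA ->].
by apply: mem_edges; have := subsetP sAN z zA; rewrite inE.
Qed.

Lemma degreeE (G : sgraph) (x : G) : degree x = #|neighbours x|.
Proof. by []. Qed.

Lemma edge_degreeE (G : sgraph) (x y : G) : adj x y ->
  edge_degree x y = #|neighbours x :\ y| + #|neighbours y :\ x|.
Proof.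
move=> xy; rewrite /edge_degree !degreeE.
rewrite (cardsD1 y (neighbours x)) (cardsD1 x (neighbours y)) !inE xy.
by rewrite adj_sym xy !add1n addSn addnS subn2.
Qed.

Lemma bigminn_le (I : finType) (m : nat) (P : pred I) (f : I -> nat) (i : I) :
  P i -> \big[minn/m]_(j | P j) f j <= f i.
Proof.
move=> Pi; rewrite -Order.NatOrder.minEnat -Order.NatOrder.leEnat.
exact: (Order.TotalTheory.bigmin_le_cond (T := nat)).
Qed.

Lemma min_degree_le (G : sgraph) (x : G) : min_degree G <= degree x.
Proof. exact: bigminn_le. Qed.

Lemma min_degree_attained (G : sgraph) (x : G) :
  exists y : G, degree y = min_degree G.
Proof.
have [y _ ymin] := arg_minnP (P := predT) (i0 := x) (@degree G) isT.
exists y; apply/eqP; rewrite eqn_leq min_degree_le andbT.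
(* The default [#|G|] of the iterated minimum bounds every degree, so it cannot lie below the
   attained value. *)
apply: (big_ind (fun n => degree y <= n)) => [|m n|i _]; last exact: ymin.
  exact: max_card.
by rewrite leq_min => -> ->.
Qed.

Lemma min_edge_degree_le (G : sgraph) (x y : G) :
  adj x y -> min_edge_degree G <= edge_degree x y.
Proof.
move=> xy.
exact: (bigminn_le _ (P := fun p => adj p.1 p.2) (fun p => edge_degree p.1 p.2)
  (i := (x, y))).
Qed.

Lemma min_edge_degree_attained (G : sgraph) (u v : G) : adj u v ->
  exists x y : G, adj x y /\ edge_degree x y = min_edge_degree G.
Proof.
move=> uv; have [[x y] /= xy xymin] := arg_minnP
  (P := fun p => adj p.1 p.2) (i0 := (u, v)) (fun p => edge_degree p.1 p.2) uv.
exists x, y; split=> //; apply/eqP; rewrite eqn_leq min_edge_degree_le // andbT.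
apply: (big_ind (fun n => edge_degree x y <= n)) => [|m n|i]; last exact: xymin.
  by apply: leq_trans (leq_subr _ _) _; apply: leq_add; apply: max_card.
by rewrite leq_min => -> ->.
Qed.

(** * Components after deletion, and extra edge-cuts *)

Lemma del_connect_sym (G : sgraph) (F : {set {set G}}) :
  connect_sym (del_adj F).
Proof. by apply: sym_connect_sym; apply: del_adj_sym. Qed.

Lemma connected_neighbour (G : sgraph) (x y : G) :
  connect (@adj G) x y -> x != y -> exists z : G, adj x z.
Proof.
case/connectP=> -[|z p] /=; last by case/andP=> xz _ _ _; exists z.
by move=> _ ->; rewrite eqxx.
Qed.

(** Every component is the class of one of its vertices, so component sizes can be tested vertex by
    vertex. *)
Lemma extra_edge_cutP (h : nat) (G : sgraph) (F : {set {set G}}) :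
  reflect [/\ F \subset edges G, ~~ connected (del_edges F)
            & forall x : G, h < #|del_class F x|]
          (extra_edge_cut h F).
Proof.
have classE x : [set y in [set: G] | connect (del_adj F) x y] = del_class F x.
  by apply/setP=> y; rewrite !inE.
apply: (iffP and3P) => -[FE ncF large]; split=> //.
  move=> x; have := implyP (forallP large (del_class F x)); apply.
  by apply/imsetP; exists x; rewrite ?inE ?classE.
apply/forallP=> C; apply/implyP=> /imsetP[x _ ->].
by have := large x; rewrite -classE.
Qed.

(** A path from [x] to a second vertex of its class starts with an edge at [x]. For [h = 1], the
    size condition of an extra edge-cut thus says that [G - F] has no isolated vertex. *)
Lemma card_del_class_gt1 (G : sgraph) (F : {set {set G}}) (x : G) :
  reflect (exists y, del_adj F x y) (1 < #|del_class F x|).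
Proof.
have xC : x \in del_class F x by rewrite inE connect0.
apply: (iffP idP) => [|[y xy]].
  rewrite (cardsD1 x) xC ltnS => /card_gt0P[y]; rewrite !inE => /andP[nyx xy].
  by apply: (@connected_neighbour (del_edges F) x y); rewrite 1?eq_sym.
rewrite (cardsD1 x) xC ltnS; apply/card_gt0P; exists y.
rewrite !inE connect1 // andbT; apply: contraTneq xy => ->.
by rewrite del_adj_irr.
Qed.

Lemma lambda_le (h : nat) (G : sgraph) (F : {set {set G}}) :
  extra_edge_cut h F -> lambda h G <= #|F|.
Proof. exact: bigminn_le. Qed.

(** Deleting [F] and then [F'] leaves the same adjacency as deleting [F :|: F']. *)
Lemma extra_edge_cut_del (h : nat) (G : sgraph) (F F' : {set {set G}}) :
  F \subset edges G -> extra_edge_cut (G := del_edges F) h F' ->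
  extra_edge_cut h (F :|: F').
Proof.
move=> FE /extra_edge_cutP[F'E ncF' large].
have eq_del : del_adj (G := del_edges F) F' =2 del_adj (F :|: F').
  by move=> x y; rewrite /del_adj /= /del_adj inE negb_or andbA.
apply/extra_edge_cutP; split.
- rewrite subUset FE; apply: subset_trans F'E _.
  apply/subsetP=> _ /imsetP[[x y] xyF ->]; apply: mem_edges.
  by move: xyF; rewrite inE => /andP[].
- apply: contra ncF' => /forallP conF; apply/forallP=> x; apply/forallP=> y.
  by rewrite /= (eq_connect eq_del); have /forallP := conF x; apply.
move=> x; apply: leq_trans (large x) (subset_leq_card _).
by apply/subsetP=> y; rewrite !inE (eq_connect eq_del).
Qed.

(** * Edge-cuts and edge-degrees *)

(** A component with two vertices is a single edge [xy]. All other edges at [x] or [y] leave it,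
    hence lie in [F]. *)
Lemma edge_degree_le_cut (G : sgraph) (F : {set {set G}}) (x : G) :
  #|del_class F x| = 2 -> exists2 y : G, adj x y & edge_degree x y <= #|F|.
Proof.
move=> class2; have [y xy] : exists y, del_adj F x y.
  by apply/card_del_class_gt1; rewrite class2.
have Gxy : adj x y by case/andP: xy.
have nyx : y != x by apply: contraTneq Gxy => ->; rewrite adj_irr.
have classE : del_class F x = [set x; y].
  apply/esym/eqP; rewrite eqEcard class2 cards2 eq_sym nyx andbT.
  by rewrite subUset !sub1set !inE connect0 connect1.
have edges_toF u v : [set u; v] = [set x; y] -> u != v ->
    edges_to u (neighbours u :\ v) \subset F.
  move=> uvE nuv; apply/subsetP=> _ /imsetP[z zN ->].
  move: zN; rewrite !inE => /andP[nzv uz].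
  have nzu : z != u by apply: contraTneq uz => ->; rewrite adj_irr.
  have : z \notin del_class F x by rewrite classE -uvE !inE negb_or nzu.
  have : u \in del_class F x by rewrite classE -uvE set21.
  rewrite inE => xu; apply: contraR => uzF; rewrite inE.
  by apply: connect_trans xu (connect1 _); rewrite /del_adj uz.
exists y => //; rewrite edge_degreeE //.
have sFx : edges_to x (neighbours x :\ y) \subset F.
  by apply: edges_toF; rewrite // eq_sym.
have sFy : edges_to y (neighbours y :\ x) \subset F.
  by apply: edges_toF; rewrite // setUC.
rewrite -(card_edges_to x) -(card_edges_to y (_ :\ _)) -cardsUI.
(* Only the edge [xy] itself meets both ends, and it is excluded from both sets. *)
have -> : edges_to x (neighbours x :\ y) :&: edges_to y (neighbours y :\ x)
    = set0.
  apply/setP=> e; rewrite !inE; apply/negP=> /andP[/imsetP[z zN ->]].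
  by rewrite mem_edges_to eq_sym (negbTE nyx) /= !inE eqxx /= andbF.
by rewrite cards0 addn0 subset_leq_card // subUset sFx.
Qed.

(* With [xy] an edge of minimum edge-degree, cut off [x], [y] and all vertices
   whose neighbours lie in [{x, y}]. *)
Lemma exists_extra_edge_cut1 (G : sgraph) :
  connected G -> 3 < #|G| -> not_star G ->
  exists2 F : {set {set G}}, extra_edge_cut 1 F & #|F| <= min_edge_degree G.
Proof.
move=> conG cardG nstarG.
have nbr (u : G) : exists v, adj u v.
  have [v nvu] := exists_neq u (ltn_trans (isT : 1 < 3) cardG).
  apply: (@connected_neighbour _ u v); last by rewrite eq_sym.
  by have /forallP := forallP conG u; apply.
have [x0 _] : exists x0 : G, x0 \in G by apply/card_gt0P; case: #|G| cardG.
have [y0 xy0] := nbr x0.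
have [x [y [xy xymin]]] := min_edge_degree_attained xy0.
have nyx : y != x by apply: contraTneq xy => ->; rewrite adj_irr.
pose S := [set x; y] :|: [set z | neighbours z \subset [set x; y]].
have xS : x \in S by rewrite !inE eqxx.
have yS : y \in S by rewrite !inE eqxx orbT.
have [[z0 z0S]|full] : (exists z, z \notin S) \/ (forall z, z \in S).
- have [z zS|inS] := pickP [pred z | z \notin S]; first by left; exists z.
  by right=> z; apply: negbFE (inS z).
(* The other vertices of [S] have all their neighbours in [[set x; y]], so [F] consists of all edges
   leaving [S]. *)
- pose F := edges_to x (neighbours x :\: S) :|: edges_to y (neighbours y :\: S).
  have FE u v : ([set u; v] \in F) =
      [|| (u == x) && (v \in neighbours x :\: S),
          (v == x) && (u \in neighbours x :\: S),
          (u == y) && (v \in neighbours y :\: S)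
        | (v == y) && (u \in neighbours y :\: S)].
    by rewrite inE !mem_edges_to -orbA.
  have keep u v : adj u v -> (u \in S) = (v \in S) -> del_adj F u v.
    move=> uv eqS; rewrite /del_adj uv FE !in_setD.
    by apply/negP=> /or4P[] /and3P[/eqP eq_end /negP nS _]; apply: nS;
      move: eqS; rewrite eq_end ?xS ?yS // => <-.
  exists F.
    apply/extra_edge_cutP; split.
    + by rewrite subUset !edges_to_sub // subsetDl.
    + apply/negP=> /forallP /(_ x) /forallP /(_ z0) /= xz0.
      have clS : closed (del_adj F) S.
        apply: (intro_closed (@del_connect_sym _ F)) => u v /andP[uv uvF] uS.
        apply: contraR uvF => vS; rewrite FE.
        have [eqx|nux] := eqVneq u x.
          by rewrite in_setD vS -eqx inE uv.
        have [eqy|nuy] := eqVneq u y.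
          by rewrite !in_setD vS -eqy !inE uv !orbT.
        have := uS; rewrite !inE (negbTE nux) (negbTE nuy) /= => /subsetP/(_ v).
        rewrite inE uv => /(_ isT) vxy; case/negP: vS.
        by rewrite inE vxy.
      have := closed_connect clS xz0; rewrite /= xS.
      by move/esym; apply/negP.
    + move=> u; apply/card_del_class_gt1; case: (boolP (u \in S)) => uS.
        have [eqx|nux] := eqVneq u x.
          by exists y; apply: keep; rewrite eqx // xS yS.
        have [eqy|nuy] := eqVneq u y.
          by exists x; apply: keep; rewrite eqy 1?adj_sym // xS yS.
        have [v uv] := nbr u; exists v; apply: keep; rewrite // uS.
        move: uS; rewrite !inE (negbTE nux) (negbTE nuy) /= => /subsetP/(_ v).
        by rewrite !inE uv => /(_ isT) ->.
      (* A vertex [u] outside [S] has a neighbour [v] outside [[set x; y]]. As [u] is a neighbour of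
         [v] outside [[set x; y]], [v] is not in [S] either, and [uv] survives. *)
      have := uS; rewrite !inE negb_or => /andP[nuxy /subsetPn[v]].
      rewrite inE => uv nvxy; exists v; apply: keep => //.
      rewrite (negbTE uS); apply/esym/negbTE; rewrite !inE negb_or.
      rewrite !inE in nvxy; rewrite nvxy; apply/subsetPn; exists u.
        by rewrite inE adj_sym.
      by rewrite !inE.
  (* Since [x] and [y] lie in [S], [F] omits the edge [xy], and the edge-degree counts all other
     edges at its ends. *)
  rewrite -xymin edge_degreeE //; apply: leq_trans (leq_card_setU _ _) _.
  rewrite !card_edges_to; apply: leq_add; apply: subset_leq_card; apply: setDS.
    by rewrite sub1set.
  by rewrite sub1set.
(* In the remaining case [S] contains every vertex; this will contradict [3 < #|G|]. *)
have nbrS z : z != x -> z != y -> neighbours z \subset [set x; y].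
  by move=> nzx nzy; have := full z; rewrite !inE (negbTE nzx) (negbTE nzy).
(* As [G] is not a star, both [x] and [y] have a further neighbour, and the
   minimality of [xy] then forces [G] to be a triangle. *)
have other a b : [set a; b] = [set x; y] -> exists w, w \in neighbours a :\ b.
  move=> ab; have [u [v [uv nub nvb]]] := nstarG b.
  have [equa|nua] := eqVneq u a.
    by exists v; rewrite !inE nvb -equa.
  exists u; rewrite !inE nub adj_sym.
  have : v \in [set a; b].
    rewrite ab; have /subsetP : neighbours u \subset [set x; y].
      have : u \notin [set a; b] by rewrite !inE negb_or nua.
      by rewrite ab !inE negb_or => /andP[]; apply: nbrS.
    by apply; rewrite inE.
  by rewrite !inE (negbTE nvb) orbF => /eqP <-.
(* Comparing the edge-degrees of [ab] and [az] cancels the degree of [a]: [b] has at most as many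
   neighbours besides [a] as [z] has, and [z] has at most one, namely [b]. *)
have tri a b z : [set a; b] = [set x; y] -> adj a b ->
    edge_degree a b = min_edge_degree G -> z \in neighbours a :\ b ->
    neighbours b :\ a = [set z].
  move=> ab Gab abmin; rewrite !inE => /andP[nzb az].
  have nza : z != a by apply: contraTneq az => ->; rewrite adj_irr.
  have sub : neighbours z :\ a \subset [set b].
    have : z \notin [set a; b] by rewrite !inE negb_or nza.
    rewrite ab !inE negb_or => /andP[nzx nzy].
    have /subsetP := nbrS _ nzx nzy; rewrite -ab => sub.
    apply/subsetP=> t; rewrite !inE => /andP[nta zt].
    by have := sub t; rewrite !inE zt (negbTE nta) /=; apply.
  have := min_edge_degree_le az; rewrite -abmin !edge_degreeE //.
  have -> : #|neighbours a :\ z| = #|neighbours a :\ b|.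
    apply: (@addnI 1).
    have := cardsD1 z (neighbours a); have := cardsD1 b (neighbours a).
    by rewrite !inE Gab az => <-.
  rewrite leq_add2l => le_ba.
  have [w wba] : exists w, w \in neighbours b :\ a
    by apply: other; rewrite setUC.
  have gt0 : 0 < #|neighbours b :\ a| by apply/card_gt0P; exists w.
  have zb : adj z b.
    have /card_gt0P[t tza] := leq_trans gt0 le_ba.
    have := subsetP sub t tza; rewrite inE => /eqP eqtb.
    by move: tza; rewrite eqtb !inE => /andP[].
  apply/esym/eqP; rewrite eqEcard sub1set !inE nza adj_sym zb cards1.
  by apply: leq_trans le_ba _; have := subset_leq_card sub; rewrite cards1.
have [z zA] := other x y (erefl _).
have [w wB] : exists w, w \in neighbours y :\ x by apply: other; rewrite setUC.
have eqB := tri x y z (erefl _) xy xymin zA.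
have eqA : neighbours x :\ y = [set w].
  apply: tri => //; rewrite 1?setUC 1?adj_sym //.
  by rewrite -xymin /edge_degree addnC.
have eqwz : w = z by move: zA; rewrite eqA inE => /eqP.
(* Any further vertex would be adjacent to [x] or [y], whose only other neighbour is [z]. *)
suff : #|G| <= #|z |: [set x; y]|.
  move/(leq_trans cardG); rewrite cardsU1 cards2.
  by case: (_ \notin _); case: (_ != _).
apply: subset_leq_card; apply/subsetP=> u _; rewrite !inE.
have [_|nux] := eqVneq u x; first by rewrite orbT.
have [_|nuy] := eqVneq u y; first by rewrite !orbT.
have [v uv] := nbr u; have := subsetP (nbrS u nux nuy) v; rewrite !inE uv.
move/(_ isT)=> /orP[] /eqP eqv.
  have : u \in neighbours x :\ y by rewrite !inE nuy adj_sym -eqv.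
  by rewrite eqA eqwz inE => ->.
have : u \in neighbours y :\ x by rewrite !inE nux adj_sym -eqv.
by rewrite eqB inE => ->.
Qed.

Lemma super_lambda'_of_no_extra_edge_cut2 (G : sgraph) :
  connected G -> 3 < #|G| -> not_star G ->
  (forall F : {set {set G}}, ~~ extra_edge_cut 2 F) -> super_lambda' G.
Proof.
move=> conG cardG nstarG ncut2.
have [F0 cutF0 leF0] := exists_extra_edge_cut1 conG cardG nstarG.
have class2 (F : {set {set G}}) :
    extra_edge_cut 1 F -> exists x, #|del_class F x| = 2.
  case/extra_edge_cutP=> FE ncF large.
  have [x] : exists x, ~~ (2 < #|del_class F x|).
    apply/existsP; apply: contraR (ncut2 F); rewrite negb_exists.
    move/forallP=> all2.
    by apply/extra_edge_cutP; split=> // x; have := all2 x; rewrite negbK.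
  by rewrite -leqNgt => le2; exists x; apply/eqP; rewrite eqn_leq le2 large.
have geF (F : {set {set G}}) : extra_edge_cut 1 F -> min_edge_degree G <= #|F|.
  case/class2=> x /edge_degree_le_cut[y xy]; apply: leq_trans.
  exact: min_edge_degree_le.
apply/and3P; split.
- by rewrite /lambda_connected conG; apply/existsP; exists F0.
- rewrite eqn_leq (leq_trans (lambda_le cutF0) leF0).
  (* The default [#|edges G|] is large enough too, because [F0] is a set of edges. *)
  apply: (big_ind (fun n => min_edge_degree G <= n)) => [|m n|];
    last exact: geF.
    apply: leq_trans (geF _ cutF0) (subset_leq_card _).
    by case/extra_edge_cutP: cutF0.
  by rewrite leq_min => -> ->.
apply/forallP=> F; apply/implyP=> /andP[/class2[x x2] _].
apply/existsP; exists (del_class F x); rewrite x2 eqxx andbT.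
by apply/imsetP; exists x; rewrite // /del_class; apply/setP=> y; rewrite !inE.
Qed.

(** * Order and shape of super-lambda' graphs *)

Lemma super_lambda'_extra_edge_cut1 (G : sgraph) : super_lambda' G ->
  exists F1 : {set {set G}}, extra_edge_cut 1 F1.
Proof. by case/and3P=> /andP[_ /existsP]. Qed.

(** A 1-extra edge-cut leaves two disjoint components with at least two vertices each. *)
Lemma super_lambda'_card_gt3 (G : sgraph) : super_lambda' G -> 3 < #|G|.
Proof.
move=> superG; have [F1 /extra_edge_cutP[_ ncF1 large]] :=
  super_lambda'_extra_edge_cut1 superG.
have [x /forallPn[y nxy]] := forallPn ncF1.
rewrite (@leq_trans (#|del_class F1 x| + #|del_class F1 y|)) //.
  by rewrite (leq_add (large x) (large y)).
rewrite -cardsUI; have -> : del_class F1 x :&: del_class F1 y = set0.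
  apply/setP=> z; rewrite !inE; apply/negP=> /andP[xz yz]; case/negP: nxy.
  apply: connect_trans xz _.
  by rewrite -[connect _ _ _]/(connect (del_adj F1) z y) del_connect_sym.
by rewrite cards0 addn0 max_card.
Qed.

(** A 1-extra edge-cut leaves some component that avoids [c], and this component contains an
    edge. *)
Lemma super_lambda'_not_star (G : sgraph) : super_lambda' G -> not_star G.
Proof.
move=> superG c; have [F1 /extra_edge_cutP[_ ncF1 large]] :=
  super_lambda'_extra_edge_cut1 superG.
have [y nyc] : exists y, ~~ connect (del_adj F1) y c.
  apply/existsP; apply: contraR ncF1; rewrite negb_exists => /forallP all_c.
  apply/forallP=> u; apply/forallP=> v; have := all_c u; have := all_c v.
  rewrite !negbK del_connect_sym => cv uc; exact: connect_trans uc cv.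
have /card_del_class_gt1[z yz] := large y.
exists y, z; split; first by case/andP: yz.
  by apply: contraNneq nyc => ->.
by apply: contraNneq nyc => <-; apply: connect1.
Qed.

(** * Deleting fewer than delta edges *)

Lemma del_adj_neighbour (G : sgraph) (F : {set {set G}}) (x : G) :
  #|F| < min_degree G -> exists y, del_adj F x y.
Proof.
move=> ltF; have [y /andP[xy xyF]|noy] := pickP (del_adj F x).
  by exists y; rewrite /del_adj xy.
have : degree x <= #|F|.
  rewrite degreeE -(card_edges_to x); apply: subset_leq_card.
  apply/subsetP=> _ /imsetP[z xz ->]; rewrite inE in xz.
  by have := noy z; rewrite /del_adj xz /= => /negbFE.
by move/(leq_trans (min_degree_le x))/(leq_trans ltF); rewrite ltnn.
Qed.

(** Fewer than delta deletions isolate no vertex, so a disconnecting [F] would be a 1-extra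
    edge-cut, with at least [2 delta - 2] edges. *)
Lemma super_lambda'_del_connected (G : sgraph) (F : {set {set G}}) :
  super_lambda' G -> F \subset edges G -> #|F| < min_degree G ->
  connected (del_edges F).
Proof.
move=> superG FE ltF; have [conG eq_lambda _] := and3P superG.
have [x0 _] : exists x0 : G, x0 \in G.
  by apply/card_gt0P; apply: leq_trans (super_lambda'_card_gt3 superG).
apply/negPn/negP=> ncF; have : extra_edge_cut 1 F.
  apply/extra_edge_cutP; split=> // x.
  by apply/card_del_class_gt1; apply: del_adj_neighbour.
move/lambda_le; rewrite (eqP eq_lambda) => leF.
have [y0 /andP[xy0 _]] := del_adj_neighbour x0 ltF.
have [x [y [xy xymin]]] := min_edge_degree_attained xy0.
have le2 : min_degree G + min_degree G - 2 <= #|F|.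
  apply: leq_trans leF; rewrite -xymin leq_sub2r // leq_add //;
    exact: min_degree_le.
(* For delta = 1 the bound [2 delta - 2] is 0 and [F] is empty, so connectedness of [G] is used. A
   nonempty [F] forces [delta >= 2], whence [2 delta - 2 >= delta > #|F|]. *)
case: (posnP #|F|) => [F0|F_gt0].
  case/negP: ncF; apply/forallP=> u; apply/forallP=> v.
  have eqF : @adj G =2 del_adj F.
    by move=> a b; rewrite /del_adj (cards0_eq F0) inE andbT.
  rewrite /= -(eq_connect eqF).
  case/andP: conG => /forallP/(_ u)/forallP conG _.
  exact: conG.
move: le2; rewrite leqNgt => /negP[].
have delta_gt1 : 1 < min_degree G by exact: leq_trans ltF.
by apply: leq_trans ltF _; rewrite -addnBA ?leq_addr.
Qed.

(* In a star with centre [c], at any [w != c] all edges avoiding [c] are in [F];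
   there are at least [delta - 1] of them, so they exhaust [F].  But an edge in
   [F] cannot contain three different vertices [w]. *)
Lemma super_lambda'_del_not_star (G : sgraph) (F : {set {set G}}) :
  super_lambda' G -> #|F| < min_degree G -> not_star (del_edges F).
Proof.
move=> superG ltF.
rewrite -[not_star _]/(forall c : G, exists u v : G,
  [/\ del_adj F u v, u != c & v != c]).
move=> c; have [/existsP[u /existsP[v /and3P[uv nuc nvc]]]|star] :=
  boolP [exists u : G, exists v : G, [&& del_adj F u v, u != c & v != c]].
  by exists u, v.
have inF u v : adj u v -> u != c -> v != c -> [set u; v] \in F.
  move=> uv nuc nvc; apply: contraR star => uvF.
  apply/existsP; exists u; apply/existsP; exists v.
  by rewrite /del_adj uv uvF nuc.
have allF w : w != c -> edges_to w (neighbours w :\ c) = F.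
  move=> nwc; apply/eqP; rewrite eqEcard card_edges_to; apply/andP; split.
    apply/subsetP=> _ /imsetP[z zN ->]; move: zN; rewrite !inE => /andP[nzc wz].
    exact: inF.
  rewrite -ltnS (leq_trans ltF) // (leq_trans (min_degree_le w)) //.
  by rewrite degreeE (cardsD1 c) -[X in _ <= X]add1n leq_add2r leq_b1.
have [y [z [yz nyc nzc]]] := super_lambda'_not_star superG c.
(* Order at least 4 supplies [w]. The edge [yz] avoids [c], so it is in [F], whose edges all contain
   [w]. *)
have [w] : exists w, w \notin c |: [set y; z].
  apply/existsP; rewrite -[[exists w, _]]negbK negb_exists.
  apply/negP=> /forallP all_in; have := super_lambda'_card_gt3 superG.
  rewrite ltnNge; case/negP; apply: leq_trans (_ : #|c |: [set y; z]| <= 3).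
    apply: subset_leq_card; apply/subsetP=> w _.
    by have := all_in w; rewrite negbK.
  by rewrite cardsU1 cards2; case: (_ \notin _); case: (_ != _).
rewrite !inE !negb_or => /and3P[nwc nwy nwz].
have := inF y z yz nyc nzc; rewrite -(allF w nwc) mem_edges_to.
by rewrite ![_ == w]eq_sym (negbTE nwy) (negbTE nwz).
Qed.

(** * The value of the persistence *)

Theorem theorem2p3 (G : sgraph) (superG : super_lambda' G)
    (nlambda''G : ~~ lambda_connected 2 G) :
  is_persistence G (min_degree G - 1).
Proof.
have conG : connected G by case/and3P: superG => /andP[].
have delta_gt0 := super_lambda'_min_degree_gt0 superG.
split=> [F FE leF|m persm].
  have ltF : #|F| < min_degree G.
    by rewrite (leq_ltn_trans leF) // subn1 prednK.
  apply: super_lambda'_of_no_extra_edge_cut2.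
  - exact: super_lambda'_del_connected.
  (* [del_edges F] has the same vertex type as [G], so the order is unchanged. *)
  - exact: (super_lambda'_card_gt3 superG).
  - exact: super_lambda'_del_not_star.
  move=> F'; apply: contra nlambda''G => cutF'.
  rewrite /lambda_connected conG; apply/existsP; exists (F :|: F').
  exact: extra_edge_cut_del.
rewrite -ltnS subn1 prednK // ltnNge; apply/negP=> le_m.
have card_gt3 := super_lambda'_card_gt3 superG.
have [x0 _] : exists x0 : G, x0 \in G.
  by apply/card_gt0P; apply: leq_trans card_gt3.
have [x xmin] := min_degree_attained x0.
(* These are all delta edges at [x]; without them [x] is isolated, although [G] has other
   vertices. *)
have := persm (edges_to x (neighbours x)).
rewrite edges_to_sub // card_edges_to -degreeE xmin le_m.
move=> /(_ isT isT) /and3P[/andP[/forallP conF _] _ _].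
have [y nyx] := exists_neq x (ltn_trans (isT : 1 < 3) card_gt3).
have [|z /andP[xz /negP[]]] :=
  connected_neighbour (forallP (conF x) y); first by rewrite eq_sym.
by rewrite mem_edges_to eqxx inE xz.
Qed.
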